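(* Let $n\ge 2$ and $1\le q\le n-q$. Let $K$ be the Lie subgroup of $SU(n)$ of block diagonal matrices with diagonal blocks of dimensions $q\times q$ and $(n-q)\times(n-q)$ (the group associated with the K-P Cartan decomposition of $su(n)$ of type AIII), acting on $SU(n)$ by conjugation $x\mapsto kxk^{-1}$, $k\in K$. Then the minimum isotropy group in $K$ for this action is the discrete (Abelian) group $$H:=\{\mathbf{1},\ \omega\mathbf{1},\ \dots,\ \omega^{n-1}\mathbf{1}\},\qquad \omega:=e^{i\frac{2\pi}{n}} .$$
   Context: The K-P Cartan decomposition of type AIII is $su(n)=\mathcal{K}\oplus\mathcal{P}$, where $\mathcal{K}$ consists of the block diagonal matrices $\begin{pmatrix}A&0\\0&B\end{pmatrix}$ in $su(n)$ with $A$ of size $q\times q$, $B$ of size $(n-q)\times(n-q)$, $\mathrm{Tr}(A)+\mathrm{Tr}(B)=0$, and $\mathcal{P}$ consists of the matrices $\begin{pmatrix}0&C\\-C^\dagger&0\end{pmatrix}$ with $C$ of size $q\times(n-q)$. The isotropy group of $x\in SU(n)$ is $\{k\in K: kxk^{-1}=x\}$. Isotropy types are conjugacy classes in $K$ of isotropy groups, partially ordered by $(H_1)\le(H_2)$ iff some group in $(H_1)$ is conjugate in $K$ to a subgroup of a group in $(H_2)$. There is a minimum isotropy type; a group belonging to it is called a minimum isotropy group (here it is a single group, since $H$ is central). *)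

(* Defs.v *)
From HB Require Import structures.
From mathcomp Require Import all_boot all_order all_algebra complex.
From mathcomp Require Import all_classical all_reals all_analysis.
Set Implicit Arguments.
Unset Strict Implicit.
Unset Printing Implicit Defensive.
Import Order.TTheory GRing.Theory Num.Theory.
Import numFieldNormedType.Exports.
Local Open Scope classical_set_scope.
Local Open Scope ring_scope.
Local Open Scope complex_scope.

(* Usual topology of the complex numbers, given by the modulus.  MathComp-Analysis
   equips every abstract numFieldType with it, but not the type R[i] itself. *)
HB.instance Definition _ (R : realType) := PseudoPointedMetric.copy R[i] R[i]^o.

Section Matrices.
Variables (R : realType) (n : nat).
Implicit Types (x k A B : 'M[R[i]]_n) (G H : set 'M[R[i]]_n).

Definition SU : set 'M[R[i]]_n := [set x | x \is unitarymx /\ \det x = 1].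

Definition block_diag (q : nat) x :=
  forall i j : 'I_n, (i < q)%N != (j < q)%N -> x i j = 0.

(* S(U(q) x U(n-q)), the connected Lie subgroup of SU(n) with Lie algebra the
   block diagonal matrices of su(n). *)
Definition K_AIII (q : nat) : set 'M[R[i]]_n := [set k | SU k /\ block_diag q k].

(* Groups of matrices are represented by their underlying sets; the multiplication
   is *m, the unit 1%:M and the inverse invmx. *)
Definition is_subgroup H G :=
  [/\ H `<=` G, H 1%:M, (forall A B, H A -> H B -> H (A *m B))
    & forall A, H A -> H (invmx A)].

Definition commutative_set H := forall A B, H A -> H B -> A *m B = B *m A.

Definition discrete_set H := H `<=` isolated H.

Definition conj_by k x := k *m x *m invmx k.

Section Isotropy.
Variable K : set 'M[R[i]]_n.

Definition isotropy_group x : set 'M[R[i]]_n := [set k | K k /\ conj_by k x = x].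

Definition conj_class H : set (set 'M[R[i]]_n) :=
  [set G | exists2 k, K k & G = conj_by k @` H].

Definition isotropy_type (T : set (set 'M[R[i]]_n)) :=
  exists2 x, SU x & T = conj_class (isotropy_group x).

Definition type_le (T1 T2 : set (set 'M[R[i]]_n)) :=
  exists H1 H2, [/\ T1 H1, T2 H2 & exists2 k, K k & conj_by k @` H1 `<=` H2].

Definition minimum_isotropy_type (T : set (set 'M[R[i]]_n)) :=
  isotropy_type T /\ forall T', isotropy_type T' -> type_le T T'.

Definition minimum_isotropy_group H :=
  exists2 T, minimum_isotropy_type T & T H.

End Isotropy.

Definition omega : R[i] := cos (2 * pi / n%:R) +i* sin (2 * pi / n%:R).

Definition scalar_group : set 'M[R[i]]_n :=
  [set A | exists2 j : nat, (j < n)%N & A = (omega ^+ j)%:M].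

End Matrices.

Arguments SU R n : clear implicits.
Arguments K_AIII R n q : clear implicits.
Arguments omega R n : clear implicits.
Arguments scalar_group R n : clear implicits.

(* Main.v *)
(** Scalar matrices commute with everything, so the scalar group lies in every
isotropy group and is fixed by conjugation; it remains to find one [x] in SU(n)
whose isotropy group is exactly the scalar group.  Take [x] to be a multiple of
the cyclic shift of the basis.  A matrix commuting with it is circulant, its
entries being constant along the cyclic diagonals [j - i = d].  For [d != 0]
each such diagonal meets an off-diagonal block, where a block diagonal matrix
vanishes, so a block diagonal matrix commuting with [x] is scalar. *)

Require Import Defs.
From mathcomp Require Import all_boot all_order all_algebra complex.
From mathcomp Require Import all_classical all_reals all_analysis.
From mathcomp Require Import all_fingroup spectral.
From mathcomp Require Import zify ring lra.
Set Implicit Arguments.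
Unset Strict Implicit.
Unset Printing Implicit Defensive.
Import Order.TTheory GRing.Theory Num.Theory.
Local Open Scope classical_set_scope.
Local Open Scope ring_scope.
Local Open Scope complex_scope.

(** * Unitary matrices and roots of unity *)

Section Unitary.
Variables (C : numClosedFieldType) (m : nat).

Lemma scale_unitary (c : C) (A : 'M[C]_m) :
  `|c| = 1 -> A \is unitarymx -> c *: A \is unitarymx.
Proof.
move=> c1 /unitarymxP AA; apply/unitarymxP.
by rewrite linearZ /= map_mxZ -scalemxAl -scalemxAr scalerA AA -normCK c1
  expr1n scale1r.
Qed.

Lemma perm_mx_unitary (s : 'S_m) : (perm_mx s : 'M[C]_m) \is unitarymx.
Proof.
by apply/unitarymxP; rewrite tr_perm_mx map_perm_mx -perm_mxM mulgV perm_mx1.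
Qed.

Lemma unity_norm (c : C) : (0 < m)%N -> c ^+ m = 1 -> `|c| = 1.
Proof.
move=> m_gt0 c_m; apply/eqP.
by rewrite -(@pexpr_eq1 _ _ m) // -normrX c_m normr1.
Qed.

End Unitary.

(** * Primitivity of [omega] as an n-th root of unity *)

Section Omega.
Variables (R : realType) (n : nat).
Hypothesis n_gt0 : (0 < n)%N.
Local Notation w := (omega R n).

Lemma omegaX j :
  w ^+ j = cos (2 * pi / n%:R *+ j) +i* sin (2 * pi / n%:R *+ j).
Proof.
elim: j => [|j IHj]; first by rewrite expr0 mulr0n cos0 sin0.
rewrite exprS IHj /omega [_ *+ j.+1]mulrS cosD sinD; simpc.
by congr (_ +i* _); rewrite addrC.
Qed.

Lemma omega_primitive : n.-primitive_root w.
Proof.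
have n0 : n%:R != 0 :> R by rewrite pnatr_eq0 -lt0n.
have w_n : w ^+ n = 1.
  rewrite omegaX -mulr_natr mulfVK // mulrC mulr_natr.
  by rewrite cos2pi sin2pi.
apply/andP; split=> //; apply/forallP => i.
rewrite unity_rootE; apply/eqP.
have [->|i_n] := eqVneq i.+1 n; first by rewrite w_n eqxx.
apply/negbTE; rewrite omegaX.
(* [t] is half the angle of [w ^+ i.+1]. The real part of that power is 1 - 2 sin(t)^2, which is
   below 1 since sin is positive on (0, pi). *)
set t : R := pi / n%:R *+ i.+1.
have t_bounds : 0 < t < pi.
  rewrite /t -mulr_natr; have := pi_gt0 R; set p := pi => p_gt0.
  have i_lt : i.+1%:R < n%:R :> R by rewrite ltr_nat ltn_neqAle i_n ltn_ord.
  apply/andP; split; first by rewrite mulr_gt0 ?divr_gt0 ?ltr0n.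
  by rewrite mulrAC ltr_pdivrMr ?ltr0n // ltr_pM2l.
have -> : 2 * pi / n%:R *+ i.+1 = t *+ 2 by rewrite /t; ring.
rewrite eq_complex /= cos_mulr2n cos2sin2 negb_and.
have := sin_gt0_pi t_bounds => s_gt0.
by rewrite lt_eqF //; nra.
Qed.

End Omega.

(** * The scalar group among the isotropy groups *)

Section Scalars.
Variables (R : realType) (n q : nat).
Hypothesis n_gt0 : (0 < n)%N.
Local Notation K := (K_AIII R n q).
Local Notation H := (scalar_group R n).
Implicit Types (c : R[i]) (A k x : 'M[R[i]]_n).

(** By primitivity the powers of [omega] exhaust the n-th roots of unity. As [c ^+ n] is the
    determinant of [c%:M], membership of a scalar matrix becomes a determinant condition. *)
Lemma scalar_groupP A : H A <-> exists2 c, c ^+ n = 1 & A = c%:M.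
Proof.
have w_prim := omega_primitive R n_gt0.
split=> [[j _ ->]|[c c_n ->]].
  exists (omega R n ^+ j) => //.
  by rewrite exprAC (prim_expr_order w_prim) expr1n.
by have [j ->] := prim_rootP w_prim c_n; exists j => //=.
Qed.

Lemma scalar_K c : c ^+ n = 1 -> K c%:M.
Proof.
move=> c_n; split; last first.
  by move=> i j; rewrite mxE; case: (eqVneq i j) => [->|_]; rewrite ?eqxx.
split; last by rewrite det_scalar.
rewrite -scalemx1 scale_unitary ?(unity_norm n_gt0) //.
by apply/unitarymxP; rewrite trmx1 map_mx1 mulmx1.
Qed.

Lemma K_unitmx k : K k -> k \in unitmx.
Proof. by case=> -[/unitarymx_unit]. Qed.

Lemma conj_scalar k c : k \in unitmx -> conj_by k c%:M = c%:M.
Proof. by move=> k_u; rewrite /conj_by scalar_mxC mulmxK. Qed.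

Lemma scalar_group_isotropy x : H `<=` isotropy_group K x.
Proof.
move=> _ /scalar_groupP[c c_n ->]; have Kc := scalar_K c_n.
by split=> //; rewrite /conj_by -scalar_mxC mulmxK ?K_unitmx.
Qed.

Lemma conj_scalar_group k : K k -> conj_by k @` H = H.
Proof.
move=> /K_unitmx k_u; apply/seteqP; split.
  move=> _ [_ /scalar_groupP[c c_n ->] <-].
  by rewrite conj_scalar //; apply/scalar_groupP; exists c.
move=> _ /scalar_groupP[c c_n ->]; exists c%:M; last exact: conj_scalar.
by apply/scalar_groupP; exists c.
Qed.

Lemma K1 : K 1%:M. Proof. by apply: scalar_K; rewrite expr1n. Qed.

Lemma conj_class_scalar_group : conj_class K H = [set H].
Proof.
apply/seteqP; split=> [G [k Kk ->]|_ ->]; first exact: conj_scalar_group.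
by exists 1%:M; [exact: K1 | rewrite conj_scalar_group //; exact: K1].
Qed.

Lemma conj_by_inj k : k \in unitmx -> injective (conj_by k).
Proof.
move=> k_u A B; rewrite /conj_by => /(congr1 (mulmx^~ k)).
by rewrite !mulmxKV // => /(congr1 (mulmx (invmx k))); rewrite !mulKmx.
Qed.

(** One point with isotropy group [H] suffices: [H] lies in every isotropy group, so its type is a
    minimum. Conversely, an isotropy group of minimum type is conjugate into [H], which conjugation
    fixes, so it is squeezed between [H] and [H]. *)
Lemma minimum_isotropy_groupP G :
    (exists2 x, SU R n x & isotropy_group K x = H) ->
  minimum_isotropy_group K G <-> G = H.
Proof.
move=> [x0 SUx0 iso_x0].
have typeH : isotropy_type K [set H].
  by exists x0; rewrite ?iso_x0 ?conj_class_scalar_group.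
split=> [[T [[x SUx ->] T_min] [k Kk ->]]|->]; last first.
  exists [set H] => //; split=> // _ [x SUx ->].
  exists H, (isotropy_group K x); split=> //; last first.
    exists 1%:M; first exact: K1.
    by rewrite conj_scalar_group; [exact: scalar_group_isotropy | exact: K1].
  exists 1%:M; first exact: K1.
  apply/seteqP; split=> [A Ax|_ [A Ax <-]].
    by exists A; rewrite /conj_by ?invmx1 ?mulmx1 ?mul1mx.
  by rewrite /conj_by invmx1 mulmx1 mul1mx.
have [_ [_ [[k1 Kk1 ->] -> [k2 Kk2 sub]]]] := T_min _ typeH.
(* Writing [H] as its own double conjugate lets injectivity of conjugation cancel [k1] and [k2]. *)
rewrite -(conj_scalar_group Kk2) -(conj_scalar_group Kk1) in sub.
suff -> : isotropy_group K x = H by exact: conj_scalar_group.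
apply/seteqP; split; last exact: scalar_group_isotropy.
move=> A xA.
have [_ [B HB <-] /(conj_by_inj (K_unitmx Kk2))] :
    (conj_by k2 @` (conj_by k1 @` H)) (conj_by k2 (conj_by k1 A)).
  by apply: sub; exists (conj_by k1 A) => //; exists A.
by move=> /(conj_by_inj (K_unitmx Kk1)) <-.
Qed.

Lemma scalar_subgroup : is_subgroup H K.
Proof.
split=> [_ /scalar_groupP[c c_n ->]||A B|A].
- exact: scalar_K.
- by apply/scalar_groupP; exists 1; rewrite ?expr1n.
- move=> /scalar_groupP[a a_n ->] /scalar_groupP[b b_n ->].
  apply/scalar_groupP; exists (a * b); last by rewrite scalar_mxM.
  by rewrite exprMn a_n b_n mulr1.
- move=> /scalar_groupP[a a_n ->]; apply/scalar_groupP; exists a^-1.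
    by rewrite exprVn a_n invr1.
  by rewrite invmx_scalar.
Qed.

Lemma scalar_commutative : commutative_set H.
Proof.
by move=> _ B /scalar_groupP[c _ ->] _; rewrite scalar_mxC.
Qed.

Lemma near_neq (a b : R[i]) : a != b -> \forall z \near a, z != b.
Proof.
move=> ab; apply/nbhs_ballP; exists `|a - b|.
  by rewrite /= normr_gt0 subr_eq0.
move=> z az; have {az} : `|a - z| < `|a - b| := az.
by apply: contraTneq => ->; rewrite ltxx.
Qed.

Lemma scalar_discrete : discrete_set H.
Proof.
move=> A HA; split; first exact/mem_set.
have [a _ A_a] := (scalar_groupP A).1 HA.
pose i0 := Ordinal n_gt0.
(* One diagonal entry determines a scalar matrix, so a neighbourhood isolates [A] once this entry
   avoids the finitely many powers of [omega] other than [a]. *)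
pose V := [set B : 'M[R[i]]_n | forall j : 'I_n,
  omega R n ^+ j != a -> B i0 i0 != omega R n ^+ j].
exists V.
  apply: (@filter_forall _ _ (fun (j : 'I_n) (B : 'M[R[i]]_n) =>
    omega R n ^+ j != a -> B i0 i0 != omega R n ^+ j) _ (nbhs_filter A)) => j.
  have [->|ja] := eqVneq (omega R n ^+ j) a.
    by apply: (@filterE _ _ (nbhs_filter A)).
  have a_near : \forall z \near A i0 i0, z != omega R n ^+ j.
    by apply: near_neq; rewrite A_a mxE eqxx mulr1n eq_sym.
  apply: (@filterS _ _ (nbhs_filter A)) (coord_continuous a_near) => B Bj _.
  exact: Bj.
apply/seteqP; split=> [B [VB [j jn B_j]]|_ ->].
  have := VB (Ordinal jn); rewrite B_j mxE eqxx mulr1n /= eqxx.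
  by have [->|ja] := eqVneq (omega R n ^+ j) a => // /(_ isT).
by split=> // j; rewrite A_a mxE eqxx mulr1n eq_sym.
Qed.

End Scalars.

(** * A point whose isotropy group is the scalar group *)

Section CyclicShift.
Variables (R : realType) (n' q : nat).
Local Notation n := n'.+2.
Hypotheses (q_gt0 : (0 < q)%N) (q_le : (q <= n - q)%N).
Local Notation K := (K_AIII R n q).

Definition shift : 'S_n := perm (addIr (1 : 'I_n)).

Lemma shiftE i : shift i = i + 1. Proof. exact: permE. Qed.

(** The scalar factor has the sign of [shift] as its n-th power, which cancels the determinant of
    the permutation matrix. *)
Definition shift_mx : 'M[R[i]]_n := n.-root ((-1) ^+ shift) *: perm_mx shift.

Lemma shift_root : (n.-root ((-1) ^+ shift) : R[i]) ^+ n = (-1) ^+ shift.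
Proof. exact: rootCK. Qed.

Lemma shift_mx_SU : SU R n shift_mx.
Proof.
split; last by rewrite detZ det_perm shift_root -expr2 sqrr_sign.
apply: scale_unitary; last exact: perm_mx_unitary.
apply/eqP; rewrite -(@pexpr_eq1 _ _ n) // -normrX shift_root.
by rewrite normrX normrN1 expr1n.
Qed.

Lemma comm_shiftE (k : 'M[R[i]]_n) :
  k *m shift_mx = shift_mx *m k ->
  forall m i j : 'I_n, k (i + m) (j + m) = k i j.
Proof.
have c0 : n.-root ((-1) ^+ shift) != 0 :> R[i].
  by rewrite rootC_eq0 // signr_eq0.
rewrite -scalemxAr -scalemxAl => /(scalerI c0) comm m i j.
have step r s : k (r + 1) (s + 1) = k r s.
  (* At this entry, right multiplication moves the column back to [s] and left multiplication moves
     the row on to [r + 1]. *)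
  have := congr1 (fun A : 'M[R[i]]_n => A r (s + 1)) comm.
  rewrite -row_permE -{1}[shift]invgK -col_permE !mxE shiftE => <-.
  by congr (k _ _); apply: (@perm_inj _ shift); rewrite permKV shiftE.
rewrite -(natr_Zp m); elim: (m : nat) => [|r IHr]; first by rewrite !addr0.
by rewrite !mulrSr !addrA step.
Qed.

Lemma block_separation (d : 'I_n) :
  d != 0 -> exists a : 'I_n, (a < q)%N != ((a + d)%R < q)%N.
Proof.
move=> d0; have d_gt0 : (0 < d)%N by rewrite lt0n.
have [d_le|d_gt] := leqP d (n - q); last first.
  (* Index 0 is in the first block, while [d > n - q >= q] puts [d] in the second. *)
  by exists 0; rewrite add0r; case: d d0 d_gt0 d_gt => /= *; lia.
(* From the last index of the first block, adding [d <= n - q] lands between [q] and [n - 1], with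
   no wraparound. *)
have q1 : (q.-1 < n)%N by lia.
exists (Ordinal q1) => /=; rewrite modn_small; last by lia.
lia.
Qed.

Lemma isotropy_shift_mx : isotropy_group K shift_mx = scalar_group R n.
Proof.
apply/seteqP; split; last exact: scalar_group_isotropy.
move=> k [Kk /(congr1 (mulmx^~ k))]; rewrite mulmxKV ?(K_unitmx Kk) //.
move=> /comm_shiftE kE; have [[_ det_k] k_block] := Kk.
have k_scalar : k = (k 0 0)%:M.
  apply/matrixP => i j; rewrite mxE; have [->|ij] := eqVneq i j.
    by rewrite -{1 2}[j]add0r kE.
  have [|a sep] := @block_separation (j - i); first by rewrite subr_eq0 eq_sym.
  (* Translation by [a - i] carries the entry [(i, j)] to [(a, a + (j - i))], which lies in an
     off-diagonal block. *)
  by rewrite -(kE (a - i)) addrC subrK addrCA k_block.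
apply/scalar_groupP => //; exists (k 0 0) => //.
by rewrite -det_scalar -k_scalar.
Qed.

End CyclicShift.

Theorem theorem2 (R : realType) (n q : nat) (hn : (2 <= n)%N)
    (hq1 : (1 <= q)%N) (hq2 : (q <= n - q)%N) :
  [/\ forall G : set 'M[R[i]%C]_n,
        minimum_isotropy_group (K_AIII R n q) G <-> G = scalar_group R n,
      is_subgroup (scalar_group R n) (K_AIII R n q),
      commutative_set (scalar_group R n)
    & discrete_set (scalar_group R n)].
Proof.
case: n hn hq2 => [|[|n]] // _ hq2; split.
- move=> G; apply: minimum_isotropy_groupP => //.
  exists (shift_mx R n); [exact: shift_mx_SU | exact: isotropy_shift_mx].
- exact: scalar_subgroup.
- exact: scalar_commutative.
- exact: scalar_discrete.
Qed.
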